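(* Let $v\in V$ be a non-zero vector and $\varphi\in E^\times$ with $\varphi^{-1}-\bar{\varphi}^{-1}=h'(v,v)$, and let $s=s_{(v,\varphi)}$ be the corresponding one-dimensional element of the unitary group $\mathrm{U}(V,h')$, that is, $s(x)=x-\varphi\, h'(v,x)\,v$ for all $x\in V$. Then $$\mathrm{disc}\left(h'\big|_{\bigcup_{n\geq 1}\ker(1+s)^n}\right)\cdot{\det}_E\left(\frac{1+s}{2}\Big|_{\bigcap_{n\geq 1}\mathrm{im}(1+s)^n}\right)=\varphi \mod E_0^{\times},$$ as an equality in $E^\times/E_0^\times$.
   Context: $F$ is a field of characteristic not equal to $2$, and $E$ is a finite extension of $F$ equipped with an involution $\bar{\ }$ (a field automorphism of order two) fixing all elements of $F$. $E_0\supseteq F$ denotes the subfield of $E$ of fixed points of the involution. $V$ is a finite-dimensional $E$-vector space. $h$ is a non-degenerate hermitian form on $V$, and $h'$ is a non-degenerate anti-hermitian form on $V$ (sesquilinear with respect to $\bar{\ }$, $E$-linear in the second variable and semilinear in the first, with $h'(y,x)=-\overline{h'(x,y)}$) such that the unitary groups $\mathrm{U}(V,h')$ and $\mathrm{U}(V,h)$ coincide. $\mathrm{U}(V,h')$ is the group of $E$-linear automorphisms of $V$ preserving $h'$. The discriminant $\mathrm{disc}$ of $h'$ on a subspace $W$ (on which it is non-degenerate) is the class in $E^\times/E_0^\times$ of the determinant of a Gram matrix of $h'|_W$ in an $E$-basis of $W$. The discriminant of the form on the zero space, and the determinant of the endomorphism of the zero space, are $1$. ${\det}_E$ is the determinant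 as an $E$-linear map; the subspaces $\bigcup_{n\ge1}\ker(1+s)^n$ and $\bigcap_{n\ge1}\mathrm{im}(1+s)^n$ are stable under $s$. *)

(* Defs.v *)
From HB Require Import structures.
From mathcomp Require Import all_boot all_order all_algebra all_field.
From mathcomp Require Import sesquilinear.
Set Implicit Arguments.
Unset Strict Implicit.
Unset Printing Implicit Defensive.
Import GRing.Theory.
Local Open Scope ring_scope.
Local Open Scope quotient_scope.

(* An algebra endomorphism sigma : 'AEnd(E) is a field endomorphism of E that *)
(* is F-linear, i.e., fixes F pointwise.                                      *)
Definition involution (F : fieldType) (E : fieldExtType F) (sigma : 'AEnd(E)) :
  Prop := involutive sigma /\ ~ (sigma =1 id).

Definition fixed_field (F : fieldType) (E : fieldExtType F) (sigma : 'AEnd(E)) :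
  {subfield E} := fixedSpace_aspace sigma.

Section MultiplicativeQuotient.
Variables (F : fieldType) (E : fieldExtType F) (E0 : {subfield E}).

Definition nonzero := {x : E | x != 0}.
Implicit Types a b c : nonzero.

Definition congr_mult a b : bool := val a / val b \in E0.

Fact congr_mult_refl : reflexive congr_mult.
Proof. by move=> a; rewrite /congr_mult divff ?(valP a)// rpred1. Qed.

Fact congr_mult_sym : symmetric congr_mult.
Proof. by move=> a b; rewrite /congr_mult -[in LHS]rpredV invf_div. Qed.

Fact congr_mult_trans : transitive congr_mult.
Proof.
move=> b a c ab bc; rewrite /congr_mult.
by rewrite -(divfK (valP b) (val a)) -(mulrA (_ / _)) rpredM.
Qed.

Canonical congr_mult_equiv :=
  EquivRel congr_mult congr_mult_refl congr_mult_sym congr_mult_trans.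

(* The group E^* / E0^*.                                                      *)
Definition mult_quot := {eq_quot congr_mult_equiv}.
HB.instance Definition _ := Choice.on mult_quot.
HB.instance Definition _ := EqQuotient.on mult_quot.

Definition mult_class (x : E) (x_neq0 : x != 0) : mult_quot :=
  \pi_mult_quot (exist _ x x_neq0 : nonzero).

Lemma mult_class_eq (x y : E) (x0 : x != 0) (y0 : y != 0) :
  mult_class x0 = mult_class y0 <-> x / y \in E0.
Proof.
pose a : nonzero := exist _ x x0; pose b : nonzero := exist _ y y0.
exact: (rwP (eqmodP congr_mult_equiv a b)).
Qed.

Definition mult_quot_one : mult_quot := mult_class (oner_neq0 E).
Definition mult_quot_mul (p q : mult_quot) : mult_quot :=
  mult_class (mulf_neq0 (valP (repr p)) (valP (repr q))).
Definition mult_quot_inv (p : mult_quot) : mult_quot :=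
  mult_class (invr_neq0 (valP (repr p))).

Lemma mult_class_repr (p : mult_quot) : mult_class (valP (repr p)) = p.
Proof.
rewrite -[RHS]reprK; congr (\pi_mult_quot _); exact: val_inj.
Qed.

Let repr_class (x : E) (x0 : x != 0) : val (repr (mult_class x0)) / x \in E0.
Proof.
exact: (mult_class_eq (valP (repr (mult_class x0))) x0).1 (mult_class_repr _).
Qed.

Lemma mult_quot_mulE (x y : E) (x0 : x != 0) (y0 : y != 0) :
  mult_quot_mul (mult_class x0) (mult_class y0) = mult_class (mulf_neq0 x0 y0).
Proof.
by apply/mult_class_eq; rewrite invfM mulrACA rpredM ?repr_class.
Qed.

Lemma mult_quot_invE (x : E) (x0 : x != 0) :
  mult_quot_inv (mult_class x0) = mult_class (invr_neq0 x0).
Proof. by apply/mult_class_eq; rewrite -invfM rpredV repr_class. Qed.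

Lemma mult_classP (p : mult_quot) : exists x (x0 : x != 0), p = mult_class x0.
Proof. by exists (val (repr p)), (valP (repr p)); rewrite mult_class_repr. Qed.

Let classE (x y : E) (x0 : x != 0) (y0 : y != 0) :
  x = y -> mult_class x0 = mult_class y0.
Proof. by move=> xy; apply/mult_class_eq; rewrite xy divff ?rpred1. Qed.

Fact mult_quot_mulA : associative mult_quot_mul.
Proof.
move=> p q r; have [x [x0 ->]] := mult_classP p.
have [y [y0 ->]] := mult_classP q; have [z [z0 ->]] := mult_classP r.
by rewrite !mult_quot_mulE; apply: classE; rewrite mulrA.
Qed.

Fact mult_quot_mulC : commutative mult_quot_mul.
Proof.
move=> p q; have [x [x0 ->]] := mult_classP p.
have [y [y0 ->]] := mult_classP q.
by rewrite !mult_quot_mulE; apply: classE; rewrite mulrC.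
Qed.

Fact mult_quot_mul1 : left_id mult_quot_one mult_quot_mul.
Proof.
move=> p; have [x [x0 ->]] := mult_classP p.
by rewrite mult_quot_mulE; apply: classE; rewrite mul1r.
Qed.

Fact mult_quot_mulV : left_inverse mult_quot_one mult_quot_inv mult_quot_mul.
Proof.
move=> p; have [x [x0 ->]] := mult_classP p.
by rewrite mult_quot_invE mult_quot_mulE; apply: classE; rewrite mulVf.
Qed.

Fact mult_quot_mulr1 : right_id mult_quot_one mult_quot_mul.
Proof. by move=> p; rewrite mult_quot_mulC mult_quot_mul1. Qed.

Fact mult_quot_mulrV : right_inverse mult_quot_one mult_quot_inv mult_quot_mul.
Proof. by move=> p; rewrite mult_quot_mulC mult_quot_mulV. Qed.

HB.instance Definition _ := isGroup.Build mult_quot mult_quot_mulA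
  mult_quot_mul1 mult_quot_mulr1 mult_quot_mulV mult_quot_mulrV.

Lemma mult_classM (x y : E) (x0 : x != 0) (y0 : y != 0) :
  (mult_class x0 * mult_class y0)%g = mult_class (mulf_neq0 x0 y0).
Proof. exact: mult_quot_mulE. Qed.

End MultiplicativeQuotient.

Section Forms.
Variables (F : fieldType) (E : fieldExtType F) (sigma : 'AEnd(E)).
Variable V : vectType E.

(* Forms are semilinear in the first variable, linear in the second.          *)
Definition sesqui_form := {bilinear V -> V -> E | sigma \; *%R & *%R}.
Implicit Types (h : sesqui_form) (W : {vspace V}) (g : 'End(V)).

Definition hermitian_form h := forall x y, h y x = sigma (h x y).

Definition antihermitian_form h := forall x y, h y x = - sigma (h x y).

Definition nondegenerate_on h W :=
  forall y, y \in W -> (forall x, x \in W -> h x y = 0) -> y = 0.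

Definition in_unitary h g :=
  bijective g /\ forall x y, h (g x) (g y) = h x y.

Definition gram h n (X : n.-tuple V) : 'M[E]_n := \matrix_(i, j) h X`_i X`_j.

Lemma sesqui_sumr h n (X : n.-tuple V) (c : 'I_n -> E) x :
  h x (\sum_j c j *: X`_j) = \sum_j c j * h x X`_j.
Proof. by rewrite linear_sumr; apply: eq_bigr => j _; rewrite linearZr_LR. Qed.

Lemma sesqui_suml h n (X : n.-tuple V) (c : 'I_n -> E) y :
  h (\sum_i c i *: X`_i) y = \sum_i sigma (c i) * h X`_i y.
Proof. by rewrite linear_sumlz; apply: eq_bigr => j _; rewrite linearZl_LR. Qed.

Lemma det_gram_neq0 h W n (X : n.-tuple V) :
  basis_of W X -> nondegenerate_on h W -> \det (gram h X) != 0.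
Proof.
move=> bX ndW; rewrite -det_tr; apply/det0P => -[u u0 uG].
have XW (j : 'I_n) : X`_j \in W.
  by apply: (basis_mem bX); rewrite mem_nth ?size_tuple.
case/negP: u0; apply/eqP/rowP => j; rewrite mxE.
have y0 : \sum_j u 0 j *: X`_j = 0.
  apply: ndW => [|x xW]; first by apply: memv_suml => i _; rewrite memvZ.
  rewrite (coord_basis bX xW) sesqui_suml big1 // => i _.
  rewrite sesqui_sumr; have := congr1 (fun A : 'rV_n => A 0 i) uG.
  rewrite !mxE => e; rewrite (eq_bigr (fun k => u 0 k * (gram h X)^T k i)).
    by rewrite e mulr0.
  by move=> k _; rewrite !mxE.
by have := coord_sum_free (u 0) j (basis_free bX); rewrite y0 linear0.
Qed.

(* The non-degeneracy proof ensures that the Gram determinant lies in E^*.    *)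
Definition disc h W (ndW : nondegenerate_on h W) : mult_quot (fixed_field sigma) :=
  mult_class (fixed_field sigma) (det_gram_neq0 (vbasisP W) ndW).

(* The discriminant may be computed in any basis.                             *)
Lemma disc_basis h W (ndW : nondegenerate_on h W) n (X : n.-tuple V)
    (bX : basis_of W X) : involutive sigma ->
  disc ndW = mult_class (fixed_field sigma) (det_gram_neq0 bX ndW).
Proof.
move=> sK; move: (det_gram_neq0 bX ndW); have sz := size_basis bX.
move: X bX; case: _ / sz => X bX dX; apply/mult_class_eq.
set Y := vbasis W; have bY : basis_of W Y := vbasisP W.
pose P := \matrix_(i, j < \dim W) coord X j Y`_i.
have YE (i : 'I_(\dim W)) : Y`_i = \sum_(j < \dim W) P i j *: X`_j.
  rewrite [LHS](coord_basis bX) ?(basis_mem bY) ?mem_nth ?size_tuple //.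
  by apply: eq_bigr => j _; rewrite mxE.
have GE : gram h Y = map_mx sigma P *m gram h X *m P^T.
  apply/matrixP => i j; rewrite mxE !YE sesqui_sumr mxE.
  apply: eq_bigr => k _; rewrite sesqui_suml !mxE mulrC; congr (_ * _).
  by apply: eq_bigr => l _; rewrite !mxE.
rewrite GE !det_mulmx det_tr det_map_mx mulrAC mulfK //.
by apply/fixedSpaceP; rewrite rmorphM /= sK mulrC.
Qed.

(* For g stabilizing W: the determinant of the restriction of g to W; it is 1 *)
(* when W = 0. The matrix lists images by rows, so it is the transpose of the *)
(* usual one.                                                                 *)
Definition det_on g W : E :=
  \det (\matrix_(i, j < \dim W) coord (vbasis W) j (g (vbasis W)`_i)).

(* W is the union of the ker g^n (resp. the intersection of the im g^n) over  *)
(* n >= 1.                                                                    *)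
Definition is_union_ker g W := forall x,
  x \in W <-> exists2 n, (0 < n)%N & iter n g x = 0.

Definition is_inter_im g W := forall x,
  x \in W <-> forall n, (0 < n)%N -> exists y, x = iter n g y.

Section FittingSubspaces.
Variable g : 'End(V).

Let power n : 'End(V) := iter n (fun f => (g \o f)%VF) \1%VF.

Let powerE n x : power n x = iter n g x.
Proof. by elim: n => [|n IHn] /=; rewrite ?id_lfunE ?comp_lfunE ?IHn. Qed.

Let kerE n x : (x \in lker (power n)) = (iter n g x == 0).
Proof. by rewrite memv_ker powerE. Qed.

Let imP n x : (x \in limg (power n)) <-> exists y, x = iter n g y.
Proof.
split=> [/memv_imgP[y _ ->] | [y ->]]; first by exists y; rewrite powerE.
by rewrite -powerE memv_img ?memvf.
Qed.

Let stationary_inc (W : nat -> {vspace V}) :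
  (forall n, W n <= W n.+1)%VS -> exists n, (W n.+1 <= W n)%VS.
Proof.
move=> Winc; suff [//|] : (exists n, (W n.+1 <= W n)%VS) \/
    (\dim {:V} < \dim (W (\dim {:V}).+1))%N.
  by rewrite ltnNge dimvS ?subvf.
elim: (\dim _).+1 => [|n [|IHn]]; [by right | by left |].
have [le|nle] := boolP (W n.+1 <= W n)%VS; first by left; exists n.
right; apply: leq_ltn_trans IHn _.
by rewrite (ltn_leqif (dimv_leqif_sup (Winc n))).
Qed.

Let stationary_dec (W : nat -> {vspace V}) :
  (forall n, W n.+1 <= W n)%VS -> exists n, (W n <= W n.+1)%VS.
Proof.
move=> Wdec; suff [//|] : (exists n, (W n <= W n.+1)%VS) \/
    ((\dim {:V}).+1 + \dim (W (\dim {:V}).+1) <= \dim {:V})%N.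
  by rewrite addSn ltnNge leq_addr.
elim: (\dim _).+1 => [|n [|IHn]]; [by right; rewrite dimvS ?subvf | by left |].
have [le|nle] := boolP (W n <= W n.+1)%VS; first by left; exists n.
right; apply: leq_trans IHn; rewrite addSnnS leq_add2l.
by rewrite (ltn_leqif (dimv_leqif_sup (Wdec n))).
Qed.

Lemma exists_union_ker : exists W, is_union_ker g W.
Proof.
have inc n : (lker (power n) <= lker (power n.+1))%VS.
  by apply/subvP => x; rewrite !kerE => /eqP /= ->; rewrite linear0.
have [n0 st] := stationary_inc inc; exists (lker (power n0)) => x.
split=> [x0|[m _ m0]].
  by exists n0.+1 => //; apply/eqP; rewrite -kerE (subvP (inc n0)).
have : x \in lker (power (n0 + m)).
  rewrite kerE iterD m0; apply/eqP.
  by elim: (n0) => //= n ->; rewrite linear0.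
elim: (m) => [|k IHk]; first by rewrite addn0.
move=> xk; apply: IHk; move: xk; rewrite !kerE addnS -addSn !iterD -!kerE.
exact: (subvP st).
Qed.

Lemma exists_inter_im : exists W, is_inter_im g W.
Proof.
have dec n : (limg (power n.+1) <= limg (power n))%VS.
  by apply/subvP => x /imP[y ->]; apply/imP; exists (g y); rewrite iterSr.
have [n0 st] := stationary_dec dec; exists (limg (power n0)) => x.
split=> [x0 m _|im]; last first.
  by apply/(subvP (dec n0))/imP/im.
have : x \in limg (power (m + n0)).
  elim: m => // m /imP[y ->]; rewrite addSnnS; apply/imP.
  have /(subvP st)/imP[z yz] : iter n0 g y \in limg (power n0).
    by apply/imP; exists y.
  by exists z; rewrite !iterD yz.
by move=> /imP[y ->]; exists (iter n0 g y); rewrite iterD.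
Qed.

End FittingSubspaces.

End Forms.

(* Main.v *)
Require Import Defs.
From HB Require Import structures.
From mathcomp Require Import all_boot all_order all_algebra all_field.
From mathcomp Require Import sesquilinear ring.
Set Implicit Arguments.
Unset Strict Implicit.
Unset Printing Implicit Defensive.
Import GRing.Theory.
Local Open Scope ring_scope.

(** Put g = 1 + s, so that g x = 2 x - phi h'(v, x) v is twice the identity
minus a map of rank one with image in the line E v. That line is stable, with
g v = (2 - phi h'(v, v)) v, and the relation between phi and h'(v, v) gives
phi h'(v, v) = 1 - phi / sigma phi, so g v = (1 + phi / sigma phi) v. Since g
is multiplication by 2 modulo E v, and 2 is invertible, the Fitting
decomposition of g depends only on whether this scalar vanishes.

If it does not, g is injective ([double_sub_rank1_inj]), so K = 0 and I = V,
and [det_on_sub_rank1] gives det (g / 2) = (1 + phi / sigma phi) / 2. This is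
phi times (phi + sigma phi) / (2 phi sigma phi), and the second factor, being
built from a trace and a norm, lies in the fixed field.

If it does, sigma phi = - phi and K is the line E v
([union_ker_double_sub_rank1]), with discriminant h'(v, v) = 2 / phi. The
image of g is orthogonal to v ([inter_im_double_sub_rank1]), so g / 2 is the
identity on I and has determinant 1. It remains to see that 2 / phi and phi
have the same class: their quotient is 2 / phi ^ 2 = - 2 / (phi sigma phi). *)

(** * Determinants of perturbations of the identity *)

(** Sylvester's identity: the block matrix with identity diagonal blocks and
off-diagonal blocks B and A factors through either of its Schur
complements. *)
Lemma det_1_sub_mulmxC (R : comNzRingType) m n (A : 'M[R]_(m, n))
    (B : 'M[R]_(n, m)) :
  \det (1%:M - A *m B) = \det (1%:M - B *m A).
Proof.
have lower : block_mx 1%:M B A 1%:M =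
    block_mx 1%:M 0 A (1%:M - A *m B) *m block_mx 1%:M B 0 1%:M.
  by rewrite mulmx_block !mulmx1 !mul1mx !mulmx0 ?mul0mx !addr0 addrC subrK.
have upper : block_mx 1%:M B A 1%:M =
    block_mx 1%:M B 0 1%:M *m block_mx (1%:M - B *m A) 0 A 1%:M.
  by rewrite mulmx_block !mulmx1 !mul1mx ?mulmx0 !mul0mx !add0r subrK.
move: (congr1 determinant lower); rewrite upper !det_mulmx.
by rewrite !det_lblock !det_ublock !det1 !mul1r !mulr1.
Qed.

Section Determinants.
Variables (F : fieldType) (E : fieldExtType F) (V : vectType E).
Implicit Types (g : 'End(V)) (W : {vspace V}).

Lemma det_on_id g W : (forall x, x \in W -> g x = x) -> det_on g W = 1.
Proof.
move=> gW; rewrite -[RHS](det1 E (\dim W)); congr (\det _).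
apply/matrixP => i j; rewrite !mxE gW ?vbasis_mem ?mem_nth ?size_tuple //.
by rewrite coord_free ?(basis_free (vbasisP W)).
Qed.

(** In coordinates this is 1 - C R with C a column and R a row, so Sylvester's
identity reduces the determinant to the 1 x 1 matrix 1 - R C. *)
Lemma det_on_sub_rank1 g (c : E) (psi : {scalar V}) v :
    (forall x, g x = x - (c * psi x) *: v) ->
  det_on g fullv = 1 - c * psi v.
Proof.
move=> gE; pose b := vbasis (@fullv E V).
pose C : 'cV[E]_(\dim (@fullv E V)) := \col_i (c * psi b`_i).
pose R : 'rV[E]_(\dim (@fullv E V)) := \row_j coord b j v.
have -> : det_on g fullv = \det (1%:M - C *m R).
  congr (\det _); apply/matrixP => i j.
  rewrite !mxE big_ord1 !mxE gE linearB linearZ /=.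
  by rewrite coord_free ?(basis_free (vbasisP _)).
rewrite det_1_sub_mulmxC det_mx11 !mxE eqxx; congr (_ - _).
rewrite [in RHS](coord_vbasis (memvf v)) linear_sum mulr_sumr /=.
by apply: eq_bigr => j _; rewrite !mxE linearZ /= mulrCA.
Qed.

End Determinants.

(** * Fitting components *)

Section FittingDecomposition.
Variables (F : fieldType) (E : fieldExtType F) (V : vectType E).
Variable g : 'End(V).
Implicit Types (K I : {vspace V}).

Lemma union_ker_inj K : injective g -> is_union_ker g K -> K = 0%VS.
Proof.
move=> g_inj K_eq; apply/vspaceP => x; rewrite memv0.
apply/idP/eqP => [/K_eq[n _] | ->]; last exact: mem0v.
elim: n => //= n IHn gn0; apply: IHn; apply: g_inj.
by rewrite gn0 linear0.
Qed.

Lemma inter_im_inj I : injective g -> is_inter_im g I -> I = fullv.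
Proof.
move=> g_inj I_eq; have g_ker : lker g == 0%VS by apply/lker0P.
apply/vspaceP => x; rewrite memvf; apply/I_eq => n _.
elim: n => [|n [y ->]]; first by exists x.
by exists ((g^-1)%VF y); rewrite iterSr lker0_lfunVK.
Qed.

End FittingDecomposition.

Section DoubleMinusRankOne.
Variables (F : fieldType) (E : fieldExtType F) (V : vectType E).
Variables (g : 'End(V)) (c : E) (psi : {scalar V}) (v : V).
Hypotheses (two_neq0 : 2%:R != 0 :> E)
           (gE : forall x, g x = 2%:R *: x - (c * psi x) *: v).
Implicit Types (K I : {vspace V}).

(** The form psi is an eigenvector of the transpose of g. *)
Let psi_g x : psi (g x) = (2%:R - c * psi v) * psi x.
Proof. by rewrite gE linearB !linearZ /= mulrBl mulrAC. Qed.

(** On the kernel of g the relation [psi_g] forces psi to vanish, and g is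
multiplication by 2 where psi vanishes. *)
Lemma double_sub_rank1_inj : c * psi v != 2%:R -> injective g.
Proof.
move=> cv; suff g0 x : g x = 0 -> x = 0.
  move=> x y gxy; apply/eqP; rewrite -subr_eq0; apply/eqP/g0.
  by rewrite linearB /= gxy subrr.
move=> gx0; have /eqP := psi_g x.
rewrite gx0 linear0 eq_sym mulf_eq0 subr_eq0 eq_sym (negbTE cv) /= => /eqP psix.
move: gx0; rewrite gE psix mulr0 scale0r subr0 => /eqP.
by rewrite scaler_eq0 (negbTE two_neq0) => /eqP.
Qed.

(** As g is multiplication by 2 modulo the line of v, a vector killed by a
power of g lies on that line; conversely g v = (2 - c psi v) v = 0. *)
Lemma union_ker_double_sub_rank1 K :
  c * psi v = 2%:R -> is_union_ker g K -> K = <[v]>%VS.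
Proof.
move=> cv K_eq; apply/vspaceP => x; apply/idP/vlineP => [/K_eq[n _] | [a ->]].
  suff [a ->] : exists a, iter n g x = 2%:R ^+ n *: x - a *: v.
    move=> /eqP; rewrite subr_eq0 => /eqP xv; exists ((2%:R ^+ n)^-1 * a).
    by rewrite -scalerA -xv scalerA mulVf ?scale1r ?expf_neq0.
  elim: n => [|n [a IHn]]; first by exists 0; rewrite scale0r subr0 scale1r.
  exists (2%:R * a + c * psi (iter n g x)).
  by rewrite iterS gE {1}IHn scalerBr !scalerA -exprS -addrA -opprD -scalerDl.
apply/K_eq; exists 1%N => //=.
by rewrite linearZ /= gE cv subrr scaler0.
Qed.

Lemma inter_im_double_sub_rank1 I x :
  c * psi v = 2%:R -> is_inter_im g I -> x \in I -> psi x = 0.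
Proof.
move=> cv I_eq /I_eq/(_ 1%N isT)[y ->] /=.
by rewrite psi_g cv subrr mul0r.
Qed.

End DoubleMinusRankOne.

Theorem mainTheorem1 (F : fieldType) (char_F : 2%N \notin [pchar F])
    (E : fieldExtType F) (sigma : 'AEnd(E)) (inv_sigma : involution sigma)
    (V : vectType E)
    (h : sesqui_form sigma V) (h_herm : hermitian_form h)
    (h_nondeg : nondegenerate_on h fullv)
    (h' : sesqui_form sigma V) (h'_antiherm : antihermitian_form h')
    (h'_nondeg : nondegenerate_on h' fullv)
    (same_unitary : forall g : 'End(V), in_unitary h' g <-> in_unitary h g)
    (v : V) (v_neq0 : v != 0) (phi : E) (phi_neq0 : phi != 0)
    (phi_eq : phi^-1 - (sigma phi)^-1 = h' v v)
    (s : 'End(V)) (s_eq : forall x, s x = x - (phi * h' v x) *: v)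
    (K : {vspace V}) (K_eq : is_union_ker (\1%VF + s) K)
    (I : {vspace V}) (I_eq : is_inter_im (\1%VF + s) I) :
  exists (K_nondeg : nondegenerate_on h' K)
         (det_neq0 : det_on (2%:R^-1 *: (\1%VF + s)) I != 0),
    (disc K_nondeg * mult_class (fixed_field sigma) det_neq0)%g
    = mult_class (fixed_field sigma) phi_neq0.
Proof.
have [sK _] := inv_sigma.
have two_neq0 : 2%:R != 0 :> E.
  rewrite -(scaler_nat 2%N (1 : E)) scaler_eq0 oner_eq0 orbF.
  by move: char_F; rewrite inE.
have sphi_neq0 : sigma phi != 0 by rewrite fmorph_eq0.
have norm_fixed : phi * sigma phi \in fixed_field sigma.
  by apply/fixedSpaceP; rewrite rmorphM /= sK mulrC.
have phi_hvv : phi * h' v v = 1 - phi / sigma phi.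
  by rewrite -phi_eq mulrBr divff.
have gE x : (\1%VF + s)%VF x = 2%:R *: x - (phi * h' v x) *: v.
  by rewrite add_lfunE id_lfunE s_eq addrA scaler_nat.
(* The scalar by which g acts on v is 2 - phi h'(v, v). *)
have [phi_anti | phi_nanti] := eqVneq (phi * h' v v) 2%:R.
  have KE : K = <[v]>%VS by exact: (union_ker_double_sub_rank1 two_neq0 gE).
  have hvv_neq0 : h' v v != 0.
    by apply: contraNneq two_neq0 => hvv0; rewrite -phi_anti hvv0 mulr0.
  have det1 : det_on (2%:R^-1 *: (\1%VF + s)) I = 1.
    apply: det_on_id => x xI; rewrite scale_lfunE gE.
    rewrite (inter_im_double_sub_rank1 gE phi_anti I_eq xI).
    by rewrite mulr0 scale0r subr0 scalerA mulVf ?scale1r.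
  have K_nondeg : nondegenerate_on h' K.
    rewrite KE => _ /vlineP[a ->] /(_ v (memv_line v)) /eqP.
    rewrite linearZr_LR /= mulf_eq0 (negbTE hvv_neq0) orbF => /eqP->.
    by rewrite scale0r.
  have det_neq0 : det_on (2%:R^-1 *: (\1%VF + s)) I != 0.
    by rewrite det1 oner_neq0.
  exists K_nondeg, det_neq0.
  have bK : basis_of K [tuple v] by rewrite KE seq1_basis.
  rewrite (disc_basis K_nondeg bK sK) mult_classM; apply/mult_class_eq.
  rewrite det1 mulr1 det_mx11 mxE /=.
  have phi_sphi : phi / sigma phi = -1.
    by apply: oppr_inj; rewrite opprK -[LHS](addKr 1) -phi_hvv phi_anti addKr.
  have -> : h' v v / phi = - 2%:R / (phi * sigma phi).
    have -> : sigma phi = - phi.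
      by rewrite -[in RHS](divfK sphi_neq0 phi) phi_sphi mulN1r opprK.
    by rewrite -phi_anti; field; rewrite oppr_eq0 phi_neq0.
  by rewrite rpredM ?rpredV ?rpredN ?rpred_nat.
have g_inj := double_sub_rank1_inj two_neq0 gE phi_nanti.
have det_eq : det_on (2%:R^-1 *: (\1%VF + s)) I =
    2%:R^-1 * (1 + phi / sigma phi).
  rewrite (inter_im_inj g_inj I_eq).
  rewrite (@det_on_sub_rank1 _ _ _ _ (2%:R^-1 * phi) (h' v) v) => [|x].
    by rewrite -mulrA phi_hvv; field; rewrite two_neq0 sphi_neq0.
  by rewrite scale_lfunE gE scalerBr !scalerA mulVf ?scale1r ?mulrA.
have KE := union_ker_inj g_inj K_eq.
have K_nondeg : nondegenerate_on h' K.
  by rewrite KE => y; rewrite memv0 => /eqP.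
have det_neq0 : det_on (2%:R^-1 *: (\1%VF + s)) I != 0.
  rewrite det_eq mulf_neq0 ?invr_neq0 //.
  apply: contraNneq phi_nanti => /eqP; rewrite addr_eq0 => /eqP one_eq.
  by rewrite phi_hvv -[X in _ - X]opprK -one_eq opprK.
exists K_nondeg, det_neq0.
have bK : basis_of K [tuple] by rewrite KE nil_basis.
rewrite (disc_basis K_nondeg bK sK) mult_classM; apply/mult_class_eq.
rewrite det_mx00 mul1r det_eq.
have -> : 2%:R^-1 * (1 + phi / sigma phi) / phi =
    2%:R^-1 * (phi + sigma phi) / (phi * sigma phi).
  by field; rewrite phi_neq0 sphi_neq0 two_neq0.
rewrite !rpredM ?rpredV ?rpred_nat //.
by apply/fixedSpaceP; rewrite rmorphD /= sK addrC.
Qed.
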